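(* Fix a real $\alpha$ with $0\le\alpha\le1/2$. Consider $n\to\infty$ along even integers $n=2m$ for which $l:=\alpha n$ is an integer, and let $X$ be distributed according to $p(\cdot\mid 2m,m,2l,l)$. Then \[ \lim_{n\to\infty}\mathbb E\Bigl[\frac Xn\Bigr]=\alpha, \] and this value equals $\mu:=(1-\sqrt{1-4(\alpha\gamma+\alpha\delta+\beta\gamma)})/2$ for $\beta=\delta=\frac12-\alpha$, $\gamma=\alpha$.
   Context: For non-negative integers $n,m,k,l$ with $m,k\le n$ and $m+k-n\le l\le\min(m,k)$, let $M:=m-l$, $N:=n-m-k+l$. Let $\mathbb{C}^2$ have orthonormal basis $|0\rangle,|1\rangle$ and give $(\mathbb{C}^2)^{\otimes n}$ the induced Hermitian inner product. Define $|\Xi_{n,m|k,l}\rangle:=|1\rangle^{\otimes l}\otimes|0\rangle^{\otimes(k-l)}\otimes\binom{M+N}{M}^{-1/2}\sum_{I}|I\rangle$, the sum over all $I\in\{0,1\}^{n-k}$ with exactly $M$ ones (where $|i_1\cdots i_r\rangle=|i_1\rangle\otimes\cdots\otimes|i_r\rangle$). $\mathfrak S_n$ acts on $(\mathbb{C}^2)^{\otimes n}$ by permuting tensor factors. For $0\le x\le\lfloor n/2\rfloor$, $\mathsf P_{(n-x,x)}$ is the orthogonal projection onto the isotypic component of the irreducible $\mathfrak S_n$-representation labelled by the partition $(n-x,x)$, and $p(x\mid n,m,k,l):=\langle\Xi_{n,m|k,l}|\mathsf P_{(n-x,x)}|\Xi_{n,m|k,l}\rangle$, a probability mass function on $\{0,\dots,\lfloor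 n/2\rfloor\}$. *)

(* Defs.v *)
From HB Require Import structures.
From mathcomp Require Import all_boot all_order all_algebra all_fingroup.
From mathcomp Require Import mxrepresentation.
From mathcomp Require Import complex.
From mathcomp Require Import reals.
Set Implicit Arguments. Unset Strict Implicit. Unset Printing Implicit Defensive.
Import Order.TTheory GRing.Theory Num.Theory.
Local Open Scope ring_scope.
Local Open Scope complex_scope.

Section QubitIsotypic.
Variable R : realType.
Local Notation C := (R[i]).

(* computational basis of (C^2)^{(x)n}: bit strings f, f i = true means |1> in
   tensor factor i *)
Definition Bits (n : nat) := {ffun 'I_n -> bool}.
Definition dimV (n : nat) := #|Bits n|.

(* the permutation action of S_n on tensor factors, as a matrix acting on row
   vectors: e_f  |->  e_{f o g^-1} *)
Definition tensor_perm_mx (n : nat) (g : {perm 'I_n}) : 'M[C]_(dimV n) :=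
  \matrix_(i, j) ((enum_val j == [ffun k => (enum_val i : Bits n) (g^-1 k)%g]
                   :> Bits n)%:R).

Lemma tensor_perm_mx_repr (n : nat) :
  mx_repr [set: {perm 'I_n}] (@tensor_perm_mx n).
Proof.
split.
  apply/matrixP => i j; rewrite !mxE.
  have -> : [ffun k => (enum_val i : Bits n) ((1 : {perm 'I_n})^-1 k)%g]
            = enum_val i by apply/ffunP => k; rewrite ffunE invg1 perm1.
  by rewrite (inj_eq enum_val_inj) eq_sym.
move=> g h _ _; apply/matrixP => i j; rewrite !mxE.
rewrite (bigD1 (enum_rank ([ffun k => (enum_val i : Bits n) (g^-1 k)%g] : Bits n))) //=.
rewrite !mxE enum_rankK eqxx mul1r big1 ?addr0.
  congr (_ == _)%:R; apply/ffunP => k; rewrite !ffunE.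
  by rewrite invMg permM.
move=> k /negbTE nk; rewrite !mxE.
have -> : (enum_val k == [ffun k0 => (enum_val i : Bits n) (g^-1 k0)%g] :> Bits n) = false.
  by apply/negbTE; apply: contraFN nk => /eqP <-; rewrite enum_valK.
by rewrite mul0r.
Qed.

Definition tensor_repr (n : nat) :
  mx_representation C [set: {perm 'I_n}]%G (dimV n) :=
  MxRepresentation (tensor_perm_mx_repr n).

(* Specht module S^{(n-x,x)} realised inside the weight-x subspace of
   (C^2)^{(x)n} (which is the permutation module M^{(n-x,x)}, a tabloid being
   identified with the set of positions of |1>'s): it is spanned by the
   polytabloids  e_t = (x)_{i<x} (|0>_{a_i}|1>_{b_i} - |1>_{a_i}|0>_{b_i})
   (x) |0> on the remaining factors, for a Young tableau t of shape (n-x,x)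
   whose columns of length two are {a_i (row 1), b_i (row 2)}. *)
Definition col_pairs (n x : nat) := {ffun 'I_x -> 'I_n * 'I_n}.

Definition valid_pairs (n x : nat) (t : col_pairs n x) : bool :=
  uniq ([seq (t i).1 | i <- enum 'I_x] ++ [seq (t i).2 | i <- enum 'I_x]).

Definition polytabloid_amp (n x : nat) (t : col_pairs n x) (f : Bits n) : C :=
  if [&& valid_pairs t,
         [forall j : 'I_n, f j ==> [exists i : 'I_x, ((t i).1 == j) || ((t i).2 == j)]]
       & [forall i : 'I_x, f (t i).1 != f (t i).2]]
  then (-1) ^+ #|[set i : 'I_x | f (t i).1]| else 0.

(* rows: all polytabloids (invalid column data give zero rows) *)
Definition specht_mx (n x : nat) : 'M[C]_(#|col_pairs n x|, dimV n) :=
  \matrix_(r, j) polytabloid_amp (enum_val r) (enum_val j).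

Definition isotypic (n x : nat) : 'M[C]_(dimV n) :=
  component_mx (tensor_repr n) (<<specht_mx n x>>)%MS.

Definition adj_mx (p q : nat) (A : 'M[C]_(p, q)) : 'M[C]_(q, p) :=
  (map_mx (@conjc R) A)^T.

Definition orth_proj (d : nat) (W : 'M[C]_d) : 'M[C]_d :=
  let B := row_base W in adj_mx B *m invmx (B *m adj_mx B) *m B.

Definition P_iso (n x : nat) : 'M[C]_(dimV n) := orth_proj (isotypic n x).

Definition Xi (n m k l : nat) : 'rV[C]_(dimV n) :=
  \row_j let f : Bits n := enum_val j in
    if [&& [forall i : 'I_n, (i < l)%N ==> f i],
           [forall i : 'I_n, (l <= i < k)%N ==> ~~ f i]
         & #|[set i : 'I_n | (k <= i)%N && f i]| == (m - l)%N]
    then ((Num.sqrt ('C(n - k, m - l)%:R : R))^-1)%:C else 0.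

Definition pmf (n m k l x : nat) : C :=
  (Xi n m k l *m P_iso n x *m adj_mx (Xi n m k l)) 0 0.

Definition expect_X_over_n (n m k l : nat) : C :=
  \sum_(x < (n./2).+1) ((x%:R / n%:R) * pmf n m k l x).

End QubitIsotypic.

(* Main.v *)
Require Import Defs.
From HB Require Import structures.
From mathcomp Require Import all_boot all_order all_algebra all_fingroup.
From mathcomp Require Import mxrepresentation.
From mathcomp Require Import complex.
From mathcomp Require Import reals.
From mathcomp Require Import ring lra zify.
Import Order.TTheory GRing.Theory Num.Theory.
Local Open Scope ring_scope.
Local Open Scope complex_scope.
Set Implicit Arguments. Unset Strict Implicit. Unset Printing Implicit Defensive.

(**
Let T be the sum of all transpositions (i j) over ordered pairs, the pairs
i = j included. It is central, and it acts on the isotypic component of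
(n-x, x) as the scalar c(x) = x^2 + (n-x)^2 - 2x: the polytabloids are killed by
the operator lowering the number of ones, and on vectors with that property T is
scalar. The values c(x), x <= n/2, are distinct, so the projections P_x are
mutually orthogonal.

They also add up to the identity. The residue Q = 1 - sum_x P_x commutes with
the group and with the lowering operator. A vector of weight x that is
antisymmetric under the x column exchanges of a tableau is a multiple of its
polytabloid, so Q acts on the polytabloids of weight x by one scalar, and this
scalar is 0. A vector in the range of Q killed by lowering is then shown to
vanish by antisymmetrizing it over one more disjoint pair at a time.

Hence the mean of (c(X) - c(l))^2 is |T Xi - c(l) Xi|^2. The amplitude of T Xi
at a bit string f counts the exchanges (i j) leading f into the support D of Xi:
it is proportional to c(l) + 2l on D, to at most 2n outside, and the counts add
up to n^2 |D|. So the mean is at most 4 l^2 + 2 n^3. Since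
c(x) - c(l) = 2 (x-l) (x+l-n-1) dominates 2 (x-l)^2, the fourth moment of
X/n - l/n is O(1/n).
*)

(** * Orthogonal projections *)

Section HermitianProjection.
Variable R : realType.
Local Notation C := R[i].

Lemma adj_mxM (p q r : nat) (A : 'M[C]_(p, q)) (B : 'M[C]_(q, r)) :
  adj_mx (A *m B) = adj_mx B *m adj_mx A.
Proof. by rewrite /adj_mx map_mxM trmx_mul. Qed.

Lemma adj_mxK (p q : nat) (A : 'M[C]_(p, q)) : adj_mx (adj_mx A) = A.
Proof. by apply/matrixP => i j; rewrite !mxE conjcK. Qed.

Lemma adj_mx_inv (p : nat) (A : 'M[C]_p) : adj_mx (invmx A) = invmx (adj_mx A).
Proof. by rewrite /adj_mx map_invmx trmx_inv. Qed.

Lemma adj_mxB (p q : nat) (A B : 'M[C]_(p, q)) :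
  adj_mx (A - B) = adj_mx A - adj_mx B.
Proof. by rewrite /adj_mx map_mxB linearB. Qed.

Lemma adj_mx_sum (p q : nat) (I : Type) (r : seq I) (P : pred I)
    (A : I -> 'M[C]_(p, q)) :
  adj_mx (\sum_(i <- r | P i) A i) = \sum_(i <- r | P i) adj_mx (A i).
Proof. by rewrite /adj_mx map_mx_sum linear_sum. Qed.

Lemma row_normE (d : nat) (v : 'rV[C]_d) :
  (v *m adj_mx v) 0 0 = \sum_i `|v 0 i| ^+ 2.
Proof. by rewrite mxE; apply: eq_bigr => i _; rewrite !mxE sqr_normc. Qed.

Lemma row_norm_ge0 (d : nat) (v : 'rV[C]_d) : 0 <= (v *m adj_mx v) 0 0.
Proof. by rewrite row_normE sumr_ge0 // => i _; rewrite exprn_ge0. Qed.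

Lemma row_norm_eq0 (d : nat) (v : 'rV[C]_d) : v *m adj_mx v = 0 -> v = 0.
Proof.
move=> v0; have /eqP := row_normE v; rewrite v0 mxE eq_sym psumr_eq0; last first.
  by move=> i _; rewrite exprn_ge0.
move=> /allP vi0; apply/rowP => i; rewrite mxE; apply/eqP.
by have := vi0 i (mem_index_enum _); rewrite /= expf_eq0 /= normr_eq0.
Qed.

(** If [u] is killed by the Gram matrix, then [u *m B] has norm zero, so [u = 0] by freeness.
    Invertibility matters because [invmx] returns a singular matrix unchanged. *)
Lemma gram_unit (d p : nat) (B : 'M[C]_(p, d)) :
  row_free B -> B *m adj_mx B \in unitmx.
Proof.
move=> freeB; rewrite -row_free_unit -kermx_eq0; apply/eqP/row_matrixP => i.
rewrite row0; set u := row i _.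
have uG0 : u *m (B *m adj_mx B) = 0 by rewrite /u -row_mul mulmx_ker row0.
have uB0 : u *m B = 0.
  by apply: row_norm_eq0; rewrite adj_mxM !mulmxA -(mulmxA u) uG0 mul0mx.
by apply/eqP; rewrite -(mulmx_free_eq0 u freeB) uB0.
Qed.

Lemma orth_proj_sub (d p : nat) (W : 'M[C]_d) (A : 'M[C]_(p, d)) :
  (A *m orth_proj W <= W)%MS.
Proof.
have BW : (row_base W <= W)%MS by rewrite (eq_row_base W).
by rewrite /orth_proj mulmxA; apply: submx_trans BW; apply: mxalgebra.submxMl.
Qed.

Lemma orth_proj_id (d p : nat) (W : 'M[C]_d) (A : 'M[C]_(p, d)) :
  (A <= W)%MS -> A *m orth_proj W = A.
Proof.
move=> AW; have : (A <= row_base W)%MS by rewrite (eq_row_base W).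
case/submxP => D ->; rewrite /orth_proj.
move: (row_base W) (row_base_free W) D => B freeB D /=.
by rewrite !mulmxA -(mulmxA D B) mulmxK // gram_unit.
Qed.

Lemma orth_proj_adj (d : nat) (W : 'M[C]_d) : adj_mx (orth_proj W) = orth_proj W.
Proof.
rewrite /orth_proj; move: (row_base W) => B /=.
by rewrite !adj_mxM adj_mxK adj_mx_inv adj_mxM adj_mxK mulmxA.
Qed.

Lemma orth_proj_idem (d : nat) (W : 'M[C]_d) :
  orth_proj W *m orth_proj W = orth_proj W.
Proof. by rewrite orth_proj_id // -[orth_proj W]mul1mx orth_proj_sub. Qed.

(** With [P] the projection, stability under [A] gives [P A P = P A]; stability under its adjoint,
    after taking adjoints, gives [P A P = A P]. *)
Lemma orth_proj_comm (d : nat) (W A : 'M[C]_d) :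
  (W *m A <= W)%MS -> (W *m adj_mx A <= W)%MS ->
  orth_proj W *m A = A *m orth_proj W.
Proof.
move=> WA WA'.
have PBP B : (W *m B <= W)%MS -> orth_proj W *m B *m orth_proj W = orth_proj W *m B.
  move=> WB; apply: orth_proj_id; apply: submx_trans WB.
  by apply: submxMr; rewrite -[orth_proj W]mul1mx orth_proj_sub.
move: (orth_proj W) (orth_proj_adj W) PBP => P adjP PBP.
have -> : A *m P = adj_mx (P *m adj_mx A) by rewrite adj_mxM adj_mxK adjP.
by rewrite -(PBP _ WA') -(PBP _ WA) !adj_mxM adj_mxK adjP mulmxA.
Qed.

End HermitianProjection.

(** * Isotypic components *)

Section Components.
Variables (F : fieldType) (gT : finGroupType) (G : {group gT}) (n : nat).
Variable rG : mx_representation F G n.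

Lemma row_hom_component (U : 'M[F]_n) :
  (row_hom_mx rG (nz_row U) <= component_mx rG U)%MS.
Proof.
apply/row_subP => i; rewrite [component_mx _]unlock (sumsmx_sup i) //; exact: cyclic_mx_id.
Qed.

Lemma nz_row_component (U : 'M[F]_n) : (nz_row U <= component_mx rG U)%MS.
Proof.
apply: submx_trans (row_hom_component U).
by apply/row_hom_mxP; exists 1%:M; rewrite ?mulmx1 // scalar_mx_hom.
Qed.

Lemma component_module (U : 'M[F]_n) : mxmodule rG (component_mx rG U).
Proof. by rewrite [component_mx _]unlock sumsmx_module // => i; rewrite cyclic_mx_module. Qed.

(** The component is the sum of the modules generated by homomorphic images of the single vector
    [nz_row U]; composing a homomorphism with [A] yields another one. *)
Lemma component_centgmx (U A : 'M[F]_n) :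
  centgmx rG A -> (component_mx rG U *m A <= component_mx rG U)%MS.
Proof.
move=> cA; rewrite {1}[component_mx _]unlock sumsmxMr; apply/sumsmx_subP => i _.
rewrite (hom_cyclic_mx (centgmx_hom _ cA)) cyclic_mx_sub ?component_module //.
apply: submx_trans (row_hom_component U).
have [f uf <-] := row_hom_mxP (row_sub i (row_hom_mx rG (nz_row U))).
apply/row_hom_mxP; exists (f *m A); last by rewrite mulmxA.
apply/hom_mxP => g Gg; rewrite !mulmxA (hom_mxP uf g Gg).
by rewrite -!mulmxA (centgmxP cA).
Qed.

(** Elements of the enveloping algebra commute with homomorphisms, so every image of [nz_row U] is
    an eigenvector. The eigenspace is a submodule because [A] is central, so it contains the modules
    generated by these images. *)
Lemma component_eigen (U A : 'M[F]_n) (c : F) :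
  (A \in enveloping_algebra_mx rG)%MS -> centgmx rG A ->
  nz_row U *m A = c *: nz_row U ->
  component_mx rG U *m A = c *: component_mx rG U.
Proof.
move=> EA cA uA; suff: (component_mx rG U <= kermx (A - c%:M))%MS.
  by move/sub_kermxP; rewrite mulmxBr mul_mx_scalar => /eqP; rewrite subr_eq0 => /eqP.
rewrite [component_mx _]unlock; apply/sumsmx_subP => i _; apply: cyclic_mx_sub.
  apply: kermx_centg_module; apply/centgmxP => g Gg.
  by rewrite mulmxBl mulmxBr (centgmxP cA) // scalar_mxC.
have [f uf <-] := row_hom_mxP (row_sub i (row_hom_mx rG (nz_row U))).
apply/sub_kermxP; rewrite mulmxBr mul_mx_scalar -(hom_envelop_mxC uf EA) uA.
by rewrite scalemxAl subrr.
Qed.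

End Components.

(** * Bit strings and tensor space *)

Section TensorSpace.
Variables (R : realType) (n : nat).
Local Notation C := R[i].
Local Notation vec := 'rV[C]_(dimV n).
Local Notation Sn_mx := (tensor_perm_mx R).
Local Notation rG := (tensor_repr R n).

Definition amp (v : vec) (f : Bits n) : C := v 0 (enum_rank f).

Definition permute (g : {perm 'I_n}) (f : Bits n) : Bits n := [ffun k => f (g k)].

Definition upd (f : Bits n) (i : 'I_n) (b : bool) : Bits n :=
  [ffun k => if k == i then b else f k].

Definition wt (f : Bits n) : nat := (\sum_i f i)%N.

Lemma amp_inj (v w : vec) : (forall f, amp v f = amp w f) -> v = w.
Proof.
move=> vw; apply/rowP => j; have := vw (enum_val j).
by rewrite /amp enum_valK.
Qed.

Lemma amp0 f : amp 0 f = 0. Proof. by rewrite /amp mxE. Qed.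

Lemma ampN v f : amp (- v) f = - amp v f. Proof. by rewrite /amp mxE. Qed.

Lemma ampD v w f : amp (v + w) f = amp v f + amp w f.
Proof. by rewrite /amp mxE. Qed.

Lemma ampB v w f : amp (v - w) f = amp v f - amp w f.
Proof. by rewrite ampD ampN. Qed.

Lemma ampZ c v f : amp (c *: v) f = c * amp v f.
Proof. by rewrite /amp mxE. Qed.

Lemma amp_sum (I : finType) (P : pred I) (v : I -> vec) f :
  amp (\sum_(i | P i) v i) f = \sum_(i | P i) amp (v i) f.
Proof. by rewrite /amp summxE. Qed.

Lemma eq_mx_row (A B : 'M[C]_(dimV n)) : (forall v : vec, v *m A = v *m B) -> A = B.
Proof. by move=> AB; apply/row_matrixP => i; rewrite !rowE AB. Qed.

Lemma sum_amp (v : vec) (F : C -> C) :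
  \sum_j F (v 0 j) = \sum_(f : Bits n) F (amp v f).
Proof.
rewrite (reindex (enum_rank : Bits n -> _)) //=.
by apply: onW_bij; exists enum_val => f; rewrite ?enum_rankK ?enum_valK.
Qed.

Lemma amp_perm (g : {perm 'I_n}) v f : amp (v *m Sn_mx g) f = amp v (permute g f).
Proof.
rewrite /amp mxE (bigD1 (enum_rank (permute g f))) //= big1 ?addr0 => [|i ni].
  rewrite mxE !enum_rankK (_ : f == _) ?mulr1 //.
  by apply/eqP/ffunP => k; rewrite !ffunE permKV.
rewrite mxE enum_rankK; case: eqP => [fE|_]; last by rewrite mulr0.
case/eqP: ni; apply: (canRL enum_valK); apply/ffunP => k.
by rewrite ffunE fE ffunE permK.
Qed.

(** The lowering operator of sl_2 on tensor space, written for row vectors; the conjunct on bit [k]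
    restricts it to ones. *)
Definition lower_mx : 'M[C]_(dimV n) :=
  \matrix_(i, j) \sum_k ((enum_val i : Bits n) k
     && (enum_val j == upd (enum_val i) k false))%:R.

Lemma amp_lower v h :
  amp (v *m lower_mx) h = \sum_(k | ~~ h k) amp v (upd h k true).
Proof.
rewrite {1}/amp mxE; under eq_bigr => i _ do rewrite mxE big_distrr /=.
(* A position just lowered holds a zero in [h], so positions where [h] has a one contribute
   nothing. *)
rewrite exchange_big /= (bigID (fun k => h k)) /= big1 ?add0r => [|k hk].
  apply: eq_bigr => k hk; rewrite (bigD1 (enum_rank (upd h k true))) //=.
  rewrite !enum_rankK ffunE eqxx /= (_ : h == _) ?mulr1 ?big1 ?addr0 //.
    move=> i ni; case: andP => [[ik /eqP hE]|_]; last by rewrite mulr0.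
    case/eqP: ni; apply: (canRL enum_valK); apply/ffunP => j.
    by rewrite ffunE hE ffunE; case: eqP => [->|//].
  apply/eqP/ffunP => j; rewrite !ffunE; case: eqP => [->|//].
  exact: negbTE.
rewrite big1 // => i _; rewrite enum_rankK; case: andP => [[_ /eqP hE]|_].
  by move: hk; rewrite hE ffunE eqxx.
by rewrite mulr0.
Qed.

(** Turns homogeneity into an eigenvector equation, which passes through every commuting matrix. *)
Definition weight_mx : 'M[C]_(dimV n) :=
  diag_mx (\row_j (wt (enum_val j))%:R).

Lemma amp_weight v f : amp (v *m weight_mx) f = (wt f)%:R * amp v f.
Proof. by rewrite /amp mul_mx_diag !mxE enum_rankK mulrC. Qed.

Lemma wt_permute g (f : Bits n) : wt (permute g f) = wt f.
Proof.
by rewrite /wt [RHS](reindex_inj (@perm_inj _ g)); apply: eq_bigr => i _; rewrite ffunE.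
Qed.

Lemma wt_upd (f : Bits n) k : ~~ f k -> wt (upd f k true) = (wt f).+1.
Proof.
move=> fk; rewrite /wt (bigD1 k) //= [in RHS](bigD1 k) //= ffunE eqxx (negbTE fk).
by rewrite add0n add1n; congr _.+1; apply: eq_bigr => i /negbTE ik; rewrite ffunE ik.
Qed.

Lemma lower_cent : centgmx rG lower_mx.
Proof.
apply/centgmxP => g _; apply: eq_mx_row => v; apply: amp_inj => f.
rewrite !mulmxA /= amp_perm !amp_lower [RHS](reindex_inj (@perm_inj _ g)) /=.
apply: eq_big => [i|i _]; first by rewrite ffunE.
rewrite amp_perm; congr amp; apply/ffunP => k; rewrite !ffunE.
by rewrite (inj_eq perm_inj).
Qed.

Lemma weight_cent : centgmx rG weight_mx.
Proof.
apply/centgmxP => g _; apply: eq_mx_row => v; apply: amp_inj => f.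
by rewrite !mulmxA /= amp_perm !amp_weight amp_perm wt_permute.
Qed.

Lemma adj_perm_mx (g : {perm 'I_n}) : adj_mx (Sn_mx g) = Sn_mx g^-1.
Proof.
apply/matrixP => i j; rewrite !mxE conjc_nat; congr (nat_of_bool _)%:R.
apply/eqP/eqP => ->; apply/ffunP => k; rewrite !ffunE ?invgK.
  by rewrite permK.
by rewrite permKV.
Qed.

Lemma centgmx_adj A : centgmx rG A -> centgmx rG (adj_mx A).
Proof.
move=> cA; apply/centgmxP => g _ /=; rewrite -[g]invgK -adj_perm_mx -!adj_mxM.
by congr adj_mx; rewrite (centgmxP cA) ?inE.
Qed.

Definition transp_sum : 'M[C]_(dimV n) := \sum_i \sum_j Sn_mx (tperm i j).

Lemma transp_sum_envelop : (transp_sum \in enveloping_algebra_mx rG)%MS.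
Proof.
rewrite /transp_sum linear_sum summx_sub // => i _.
by rewrite linear_sum summx_sub // => j _; apply: (envelop_mx_id rG); rewrite inE.
Qed.

Lemma transp_sum_cent : centgmx rG transp_sum.
Proof.
apply/centgmxP => g _ /=; rewrite /transp_sum mulmx_suml mulmx_sumr.
rewrite [LHS](reindex_inj (@perm_inj _ g^-1)) /=; apply: eq_bigr => i _.
rewrite mulmx_suml mulmx_sumr.
rewrite [LHS](reindex_inj (@perm_inj _ g^-1)) /=; apply: eq_bigr => j _.
have M (h h' : {perm 'I_n}) : Sn_mx h *m Sn_mx h' = Sn_mx (h * h')%g.
  by have [_ ->] := tensor_perm_mx_repr R n; rewrite ?inE.
by rewrite !M -tpermJ /conjg invgK mulgA mulgKV.
Qed.

Lemma transp_sum_adj : adj_mx transp_sum = transp_sum.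
Proof.
rewrite /transp_sum adj_mx_sum; apply: eq_bigr => i _.
by rewrite adj_mx_sum; apply: eq_bigr => j _; rewrite adj_perm_mx tpermV.
Qed.

End TensorSpace.

(** * Polytabloids *)

Section Polytabloids.
Variables (R : realType) (n : nat).
Local Notation C := R[i].
Local Notation vec := 'rV[C]_(dimV n).
Local Notation Sn_mx := (tensor_perm_mx R).
Implicit Types (v w : vec) (f h : Bits n) (t : seq ('I_n * 'I_n)).

Definition homog v (x : nat) := forall f, amp v f != 0 -> wt f = x.

Definition antisym v t :=
  forall p, p \in t -> v *m Sn_mx (tperm p.1 p.2) = - v.

Definition points t : seq 'I_n := map fst t ++ map snd t.

Lemma homog_amp v x f : homog v x -> wt f != x -> amp v f = 0.
Proof. by move=> hv; apply: contraNeq => /hv ->. Qed.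

Lemma points_fst t p : p \in t -> p.1 \in points t.
Proof. by move=> tp; rewrite mem_cat map_f. Qed.

Lemma points_snd t p : p \in t -> p.2 \in points t.
Proof. by move=> tp; rewrite mem_cat [X in _ || X]map_f ?orbT. Qed.

Lemma points_neq t p q :
  uniq (points t) -> p \in t -> q \in t -> p.1 != q.2.
Proof.
rewrite cat_uniq => /and3P[_ /hasPn disj _] tp tq; apply: contraNneq (disj q.2 _) => [<-|].
  by rewrite map_f.
by rewrite map_f.
Qed.

Lemma permute_tperm_id f i j : f i = f j -> permute (tperm i j) f = f.
Proof. by move=> fij; apply/ffunP => k; rewrite ffunE; case: tpermP => // ->. Qed.

Lemma antisym_amp v t p f : antisym v t -> p \in t ->
  amp v (permute (tperm p.1 p.2) f) = - amp v f.
Proof. by move=> va tp; rewrite -amp_perm va // ampN. Qed.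

(** Equal bits make the exchange fix [f], so the amplitude equals its own negative. *)
Lemma antisym_neq v t f : antisym v t -> amp v f != 0 ->
  {in t, forall p, f p.1 != f p.2}.
Proof.
move=> va vf p tp; apply: contraNneq vf => fp.
have := antisym_amp f va tp; rewrite permute_tperm_id // => /eqP.
by rewrite -subr_eq0 opprK -mulr2n mulrn_eq0.
Qed.

(** Every pair holds exactly one one; these account for [size t]. *)
Lemma wt_pairs t f : uniq (points t) -> {in t, forall p, f p.1 != f p.2} ->
  wt f = (size t + \sum_(i | i \notin points t) f i)%N.
Proof.
move=> ut ft; rewrite /wt (bigID (mem (points t))) /= -big_uniq //=.
congr (_ + _)%N; rewrite big_cat /= !big_map -big_split /= -sum1_size.
rewrite big_seq [RHS]big_seq; apply: eq_bigr => p /ft.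
by case: (f p.1) (f p.2) => [] [].
Qed.

Lemma wt_ge_pairs t f : uniq (points t) -> {in t, forall p, f p.1 != f p.2} ->
  (size t <= wt f)%N.
Proof. by move=> ut ft; rewrite (wt_pairs ut ft) leq_addr. Qed.

Lemma pairs_outside t f : uniq (points t) -> {in t, forall p, f p.1 != f p.2} ->
  wt f = size t -> forall i, i \notin points t -> f i = false.
Proof.
move=> ut ft /eqP; rewrite (wt_pairs ut ft) -[X in _ == X]addn0 eqn_add2l.
rewrite sum_nat_eq0 => /forallP fi i it; have := fi i.
by rewrite it /=; case: (f i).
Qed.

(** A reference string: an antisymmetric vector of the least possible weight is determined by its
    amplitude there. *)
Definition snd_bits t : Bits n := [ffun j => j \in map snd t].

Lemma snd_bits_uniq t f : uniq (points t) -> {in t, forall p, f p.1 != f p.2} ->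
  wt f = size t -> {in t, forall p, ~~ f p.1} -> f = snd_bits t.
Proof.
move=> ut ft fwt no; apply/ffunP => i; rewrite ffunE.
have [it|it] := boolP (i \in points t); last first.
  rewrite (pairs_outside ut ft) //.
  by apply: esym; apply: contraNF it; rewrite mem_cat orbC => ->.
move: it; rewrite mem_cat => /orP[it|it].
  case/mapP: (it) => p tp ip; rewrite {1}ip (negbTE (no p tp)); apply/esym/negbTE.
  by move: ut; rewrite cat_uniq => /and3P[_ /hasPn disj _]; apply: contraTN it => /disj.
rewrite it; case/mapP: it => p tp ->; have := ft p tp; have := no p tp.
by case: (f p.1) (f p.2) => [] [].
Qed.

(* Exchanging the two bits of a pair only flips a sign, so every amplitude
   reduces to the one where all the ones sit in second components. *)
Lemma antisym_homog_eq0 v t : uniq (points t) -> antisym v t ->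
  homog v (size t) -> amp v (snd_bits t) = 0 -> v = 0.
Proof.
move=> ut va vh v0; apply: amp_inj => f; rewrite amp0.
(* Descent on the number of pairs whose one sits in the first component. *)
pose d f := #|[set i in map fst t | f i]|.
have [k] := ubnP (d f); elim: k f => // k IH f dk.
apply/eqP; case: (eqVneq (amp v f) 0) => // vf.
have ft := antisym_neq va vf; have fwt := vh _ vf.
have [/hasP[p tp fp]|/hasPn no] := boolP (has (fun p => f p.1) t); last first.
  by rewrite (snd_bits_uniq ut ft fwt no) v0 eqxx in vf.
have fp2 : f p.2 = false by have := ft p tp; rewrite fp; case: (f p.2).
suff /IH/eqP : (d (permute (tperm p.1 p.2) f) < k)%N.
  by rewrite (antisym_amp _ va tp) oppr_eq0 (negbTE vf).
rewrite ltnS in dk; apply: leq_trans dk.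
apply: proper_card; apply/properP; split; last first.
  by exists p.1; rewrite !inE map_f ?fp // ffunE tpermL fp2.
apply/subsetP => i; rewrite !inE => /andP[it]; rewrite it ffunE /=.
case: tpermP => [->|ip2|//]; first by rewrite fp2.
by case/mapP: it => q tq iq; have := points_neq ut tq tp; rewrite -iq ip2 eqxx.
Qed.

End Polytabloids.

(** * Specht modules: polytabloids, lowering, and the eigenvalue of the transposition sum *)

Section Specht.
Variables (R : realType) (n : nat).
Local Notation C := R[i].
Local Notation vec := 'rV[C]_(dimV n).
Local Notation Sn_mx := (tensor_perm_mx R).
Local Notation rG := (tensor_repr R n).

Definition polytabloid (x : nat) (t : col_pairs n x) : vec :=
  \row_j polytabloid_amp R t (enum_val j).

Definition pairs_of (x : nat) (t : col_pairs n x) : seq ('I_n * 'I_n) :=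
  [seq t i | i <- enum 'I_x].

Definition permute_pairs (x : nat) (g : {perm 'I_n}) (t : col_pairs n x) :
  col_pairs n x := [ffun i => (g (t i).1, g (t i).2)].

Lemma amp_polytabloid x (t : col_pairs n x) f :
  amp (polytabloid t) f = polytabloid_amp R t f.
Proof. by rewrite /amp mxE enum_rankK. Qed.

Lemma size_pairs_of x (t : col_pairs n x) : size (pairs_of t) = x.
Proof. by rewrite size_map size_enum_ord. Qed.

Lemma valid_pairsE x (t : col_pairs n x) : valid_pairs t = uniq (points (pairs_of t)).
Proof. by rewrite /valid_pairs /points /pairs_of -!map_comp. Qed.

Lemma pairs_ofP x (t : col_pairs n x) p :
  reflect (exists i, p = t i) (p \in pairs_of t).
Proof.
apply: (iffP mapP) => [[i _ ->]|[i ->]]; first by exists i.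
by exists i => //; rewrite mem_enum.
Qed.

Lemma polytabloid_invalid x (t : col_pairs n x) : ~~ valid_pairs t -> polytabloid t = 0.
Proof.
move=> tv; apply: amp_inj => f.
by rewrite amp_polytabloid amp0 /polytabloid_amp (negbTE tv).
Qed.

Lemma points_pairs_of x (t : col_pairs n x) j :
  (j \in points (pairs_of t)) = [exists i : 'I_x, ((t i).1 == j) || ((t i).2 == j)].
Proof.
rewrite mem_cat; apply/orP/existsP.
  case=> /mapP[p /pairs_ofP[i ->] ->]; exists i; rewrite eqxx ?orbT //.
by case=> i /orP[]/eqP <-; [left|right]; apply: map_f; apply/pairs_ofP; exists i.
Qed.

Lemma polytabloid_homog x (t : col_pairs n x) : homog (polytabloid t) x.
Proof.
move=> f; rewrite amp_polytabloid /polytabloid_amp; case: and3P; last by rewrite eqxx.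
case=> tv /forallP f0 /forallP ft _; rewrite valid_pairsE in tv.
rewrite (wt_pairs tv) ?size_pairs_of => [|p /pairs_ofP[i ->]]; last exact: ft.
rewrite big1 ?addn0 // => j jt; have := f0 j.
by rewrite -points_pairs_of (negbTE jt) implybF => /negbTE ->.
Qed.

Lemma polytabloid_antisym x (t : col_pairs n x) :
  valid_pairs t -> antisym (polytabloid t) (pairs_of t).
Proof.
move=> tv _ /pairs_ofP[i ->]; have ut := tv; rewrite valid_pairsE in ut.
have tP k : t k \in pairs_of t by apply/pairs_ofP; exists k.
apply: amp_inj => f; rewrite amp_perm ampN !amp_polytabloid.
set f' := permute _ f.
have [fi|fi] := boolP (f (t i).1 == f (t i).2).
  rewrite /f' permute_tperm_id; last exact/eqP.
  rewrite /polytabloid_amp; case: and3P => [[_ _ /forallP/(_ i)]|_].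
    by rewrite fi.
  by rewrite oppr0.
have [inj1 inj2] : injective (fun k => (t k).1) /\ injective (fun k => (t k).2).
  by move: tv; rewrite /valid_pairs cat_uniq => /and3P[/injectiveP ? _ /injectiveP].
have neq k k' : (t k).1 == (t k').2 = false by apply/negbTE/(points_neq ut).
have f'1 k : f' (t k).1 = if k == i then f (t i).2 else f (t k).1.
  rewrite ffunE; case: eqP => [->|/eqP ki]; first by rewrite tpermL.
  by rewrite tpermD // 1?eq_sym ?neq // (inj_eq inj1).
have f'2 k : f' (t k).2 = if k == i then f (t i).1 else f (t k).2.
  rewrite ffunE; case: eqP => [->|/eqP ki]; first by rewrite tpermR.
  by rewrite tpermD ?neq // (inj_eq inj2) eq_sym.
rewrite /polytabloid_amp tv /=.
have -> : [forall j, f' j ==> [exists i, ((t i).1 == j) || ((t i).2 == j)]] =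
          [forall j, f j ==> [exists i, ((t i).1 == j) || ((t i).2 == j)]].
  apply: eq_forallb => j; rewrite -points_pairs_of.
  have [|jt] := boolP (j \in _); first by rewrite !implybT.
  rewrite ffunE tpermD //; apply: contraNneq jt => <-.
    exact: points_fst.
  exact: points_snd.
have -> : [forall k, f' (t k).1 != f' (t k).2] = [forall k, f (t k).1 != f (t k).2].
  by apply: eq_forallb => k; rewrite f'1 f'2; case: (k =P i) => [->|//]; rewrite eq_sym.
case: ifP => _; last by rewrite oppr0.
(* The sets of first components holding a one, before and after the exchange, differ exactly in [i];
   this flips the sign. *)
rewrite (cardsD1 i) [in RHS](cardsD1 i) !inE f'1 eqxx.
have -> : [set k | f' (t k).1] :\ i = [set k | f (t k).1] :\ i.
  by apply/setP => k; rewrite !inE f'1; case: eqP.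
by case: (f _) (f _) fi => [] [] //= _; rewrite !exprD expr1 expr0 mul1r mulN1r ?opprK.
Qed.

Lemma polytabloid_snd_bits x (t : col_pairs n x) : valid_pairs t ->
  amp (polytabloid t) (snd_bits (pairs_of t)) = 1.
Proof.
move=> tv; have ut := tv; rewrite valid_pairsE in ut.
have tP k : t k \in pairs_of t by apply/pairs_ofP; exists k.
have f1 k : snd_bits (pairs_of t) (t k).1 = false.
  rewrite ffunE; apply/negbTE/mapP => -[p pt /eqP].
  by rewrite (negbTE (points_neq ut (tP k) pt)).
have f2 k : snd_bits (pairs_of t) (t k).2 by rewrite ffunE map_f.
rewrite amp_polytabloid /polytabloid_amp tv /=.
have -> : [forall j, snd_bits (pairs_of t) j ==>
    [exists i, ((t i).1 == j) || ((t i).2 == j)]].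
  apply/forallP => j; apply/implyP; rewrite -points_pairs_of ffunE mem_cat => ->.
  by rewrite orbT.
have -> /= : [forall i, snd_bits (pairs_of t) (t i).1 != snd_bits (pairs_of t) (t i).2].
  by apply/forallP => i; rewrite f1 f2.
by rewrite (_ : [set _ | _] = set0) ?cards0 //; apply/setP => i; rewrite !inE f1.
Qed.

(** The polytabloid has amplitude 1 at the reference string, so subtracting the right multiple
    leaves an antisymmetric homogeneous vector vanishing there, hence zero. *)
Lemma antisym_homog_polytabloid x (t : col_pairs n x) v : valid_pairs t ->
  antisym v (pairs_of t) -> homog v x -> exists c, v = c *: polytabloid t.
Proof.
move=> tv va vh; exists (amp v (snd_bits (pairs_of t))); apply/eqP; rewrite -subr_eq0.
apply/eqP; apply: (@antisym_homog_eq0 _ _ _ (pairs_of t)).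
- by rewrite -valid_pairsE.
- move=> p pt; rewrite mulmxBl -scalemxAl va // (polytabloid_antisym tv) //.
  by rewrite scalerN opprK opprB addrC.
- move=> f; rewrite size_pairs_of ampB ampZ; apply: contraNeq => fx.
  by rewrite !(homog_amp _ fx) ?mulr0 ?subr0 //; apply: polytabloid_homog.
- by rewrite ampB ampZ polytabloid_snd_bits // mulr1 subrr.
Qed.

Lemma antisym_cent v t A : centgmx rG A -> antisym v t -> antisym (v *m A) t.
Proof.
move=> cA va p pt; rewrite -mulmxA.
by have := centgmxP cA (tperm p.1 p.2) (in_setT _) => /= ->; rewrite mulmxA va // mulNmx.
Qed.

(** Lowering preserves antisymmetry in [x] disjoint pairs, which forces weight at least [x] on the
    support, yet it leaves only weight [x - 1]. *)
Lemma polytabloid_lower x (t : col_pairs n x) : polytabloid t *m lower_mx R n = 0.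
Proof.
have [tv|/polytabloid_invalid ->] := boolP (valid_pairs t); last by rewrite mul0mx.
apply: amp_inj => f; rewrite amp0; apply: contraTeq isT => wf; exfalso.
have ut := tv; rewrite valid_pairsE in ut.
have ft := antisym_neq (antisym_cent (lower_cent R n) (polytabloid_antisym tv)) wf.
have := wt_ge_pairs ut ft; rewrite size_pairs_of leqNgt => /negP; apply.
rewrite ltnNge; apply: contra wf => xf; rewrite amp_lower big1 // => k fk.
apply: (homog_amp (@polytabloid_homog _ t)).
by rewrite wt_upd // gtn_eqF.
Qed.

(** This is [n] plus twice the sum of the contents of the boxes of the partition (n-x, x). *)
Definition casimir (x : nat) : C :=
  x%:R ^+ 2 + (n%:R - x%:R) ^+ 2 - 2 * x%:R.

(** Exchanges of equal bits fix [f] and give the two squares. For each of the [x] ones, its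
    exchanges with all zeros add up to minus the amplitude, and each such pair occurs in two
    orders. *)
Lemma lower0_transp_sum v x : homog v x -> v *m lower_mx R n = 0 ->
  v *m transp_sum R n = casimir x *: v.
Proof.
move=> vh vl; apply: amp_inj => f; rewrite ampZ.
have -> : amp (v *m transp_sum R n) f = \sum_i \sum_j amp v (permute (tperm i j) f).
  rewrite mulmx_sumr amp_sum; apply: eq_bigr => i _.
  by rewrite mulmx_sumr amp_sum; apply: eq_bigr => j _; rewrite amp_perm.
have [fx|fx] := eqVneq (wt f) x; last first.
  rewrite (homog_amp vh fx) mulr0 big1 // => i _; rewrite big1 // => j _.
  by rewrite (homog_amp vh) // wt_permute.
set A := amp v f.
(* The lowered vector vanishes at [f] with bit [i] cleared: refilling [i] gives [A], refilling
   another zero gives an exchange. *)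
have swap i : f i -> \sum_(j | ~~ f j) amp v (permute (tperm i j) f) = - A.
  move=> fi; have := amp_lower v (upd f i false); rewrite vl amp0 (bigD1 i) /=; last first.
    by rewrite ffunE eqxx.
  move=> E; apply/eqP; rewrite -addr_eq0 addrC; apply/eqP; apply: etrans (esym E); congr (_ + _).
    by congr amp; apply/ffunP => k; rewrite !ffunE; case: eqP => [->|].
  apply: eq_big => [k|k fk].
    by rewrite ffunE; case: eqP => [->|_]; rewrite ?fi ?andbF ?andbT.
  congr amp; apply/ffunP => j; rewrite !ffunE.
  case: tpermP => [->|->|/eqP/negbTE -> /eqP/negbTE ->] //.
    case: eqP => [ik|_]; first by rewrite -ik fi in fk.
    by rewrite eqxx (negbTE fk).
  by rewrite eqxx fi.
have c1 : #|[pred i | f i]| = x.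
  by rewrite -fx /wt -sum1_card big_mkcond; apply: eq_bigr => i _; rewrite inE; case: (f i).
have c0 : #|[pred i | ~~ f i]|%:R = n%:R - x%:R :> C.
  have /(congr1 (fun k => k%:R : C)) := cardC [pred i | f i].
  rewrite card_ord c1 natrD => <-; rewrite addrC addKr.
  by congr _%:R; apply: eq_card.
have sum1 B : \sum_(i | f i) B = x%:R * B :> C by rewrite sumr_const c1 mulr_natl.
have sum0 B : \sum_(i | ~~ f i) B = (n%:R - x%:R) * B :> C.
  by rewrite sumr_const -c0 mulr_natl.
rewrite (bigID f) /=.
under eq_bigr => i fi.
  rewrite (bigID f) /= swap //.
  under eq_bigr => j fj do rewrite permute_tperm_id ?fi ?fj //.
  rewrite sum1; over.
rewrite sum1.
under [X in _ + X]eq_bigr => i fi do rewrite (bigID f) /=.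
(* For pairs met in the order zero, one, the sums are swapped so that [swap] applies again. *)
rewrite big_split /= exchange_big /=.
under eq_bigr => i fi.
  under eq_bigr => j _ do rewrite tpermC.
  rewrite swap //; over.
rewrite sum1.
under [X in _ + (_ + X)]eq_bigr => i fi.
  under eq_bigr => j fj do rewrite permute_tperm_id ?(negbTE fi) ?(negbTE fj) //.
  rewrite sum0; over.
rewrite sum0 /casimir -/A; ring.
Qed.

Lemma polytabloid_transp_sum x (t : col_pairs n x) :
  polytabloid t *m transp_sum R n = casimir x *: polytabloid t.
Proof.
apply: lower0_transp_sum; first exact: polytabloid_homog.
exact: polytabloid_lower.
Qed.

Lemma row_specht x r : row r (specht_mx R n x) = polytabloid (enum_val r).
Proof. by apply/rowP => j; rewrite !mxE. Qed.

Lemma polytabloid_specht x (t : col_pairs n x) : (polytabloid t <= specht_mx R n x)%MS.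
Proof. by rewrite -[t]enum_rankK -row_specht row_sub. Qed.

Lemma specht_sub x (M : 'M[C]_(dimV n)) :
  (forall t : col_pairs n x, polytabloid t *m M = 0) -> specht_mx R n x *m M = 0.
Proof. by move=> eM; apply/row_matrixP => r; rewrite row_mul row_specht eM row0. Qed.

(** The vector generating the component is a combination of polytabloids, so it has their
    eigenvalue. *)
Lemma isotypic_transp_sum x :
  isotypic R n x *m transp_sum R n = casimir x *: isotypic R n x.
Proof.
apply: component_eigen (transp_sum_envelop R n) (transp_sum_cent R n) _.
apply/eqP; rewrite -subr_eq0 -mul_mx_scalar -mulmxBr; apply/eqP/sub_kermxP.
apply: submx_trans (nz_row_sub _) _; rewrite genmxE; apply/sub_kermxP.
apply: specht_sub => t.
by rewrite mulmxBr polytabloid_transp_sum mul_mx_scalar subrr.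
Qed.

Lemma polytabloid_permute x (g : {perm 'I_n}) (t : col_pairs n x) :
  polytabloid t *m Sn_mx g = polytabloid (permute_pairs g t).
Proof.
apply: amp_inj => f; rewrite amp_perm !amp_polytabloid /polytabloid_amp.
have -> : valid_pairs (permute_pairs g t) = valid_pairs t.
  rewrite /valid_pairs -[in RHS](map_inj_uniq (@perm_inj _ g)) map_cat -!map_comp.
  by congr (uniq (_ ++ _)); apply: eq_map => i /=; rewrite ffunE.
have -> : [forall j, permute g f j ==> [exists i, ((t i).1 == j) || ((t i).2 == j)]] =
  [forall j, f j ==> [exists i, ((permute_pairs g t i).1 == j)
                             || ((permute_pairs g t i).2 == j)]].
  have E j : [exists i, ((permute_pairs g t i).1 == g j)
                     || ((permute_pairs g t i).2 == g j)] =
             [exists i, ((t i).1 == j) || ((t i).2 == j)].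
    by apply: eq_existsb => i; rewrite ffunE /= !(inj_eq perm_inj).
  apply/forallP/forallP => H j; first by have := H (g^-1 j)%g; rewrite ffunE -E permKV.
  by rewrite ffunE -E.
have fg i : (permute g f (t i).1 = f (permute_pairs g t i).1)
         * (permute g f (t i).2 = f (permute_pairs g t i).2) by rewrite !ffunE.
have -> : [forall i, permute g f (t i).1 != permute g f (t i).2] =
  [forall i, f (permute_pairs g t i).1 != f (permute_pairs g t i).2].
  by apply: eq_forallb => i; rewrite !fg.
have -> : [set i | permute g f (t i).1] = [set i | f (permute_pairs g t i).1].
  by apply/setP => i; rewrite !inE !fg.
by [].
Qed.

Lemma perm_map_exists (T : finType) (s1 s2 : seq T) : uniq s1 -> uniq s2 ->
  size s1 = size s2 -> exists g : {perm T}, map g s1 = s2.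
Proof.
elim: s1 s2 => [|a s1 IH] [|b s2] //=; first by exists 1%g.
move=> /andP[as1 u1] /andP[bs2 u2] [ss]; have [g gs] := IH _ u1 u2 ss.
(* The correction sends [g a] to [b] and fixes [s2], which contains neither point. *)
exists (g * tperm (g a) b)%g; rewrite permM tpermL; congr (_ :: _).
rewrite -[RHS]gs; apply/eq_in_map => y ys; rewrite permM tpermD //.
  by rewrite (inj_eq perm_inj); apply: contraNneq as1 => ->.
by apply: contraNneq bs2 => ->; rewrite -gs map_f.
Qed.

(** Valid column data are lists of distinct points of equal length, so the symmetric group moves any
    one to any other. *)
Lemma polytabloid_trans x (s t : col_pairs n x) : valid_pairs s -> valid_pairs t ->
  exists g : {perm 'I_n}, polytabloid s = polytabloid t *m Sn_mx g.
Proof.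
move=> us ut; have [|g] := perm_map_exists ut us.
  by rewrite !size_cat !size_map.
rewrite map_cat -(map_comp g (fun i => (t i).1)) -(map_comp g (fun i => (t i).2)) => /eqP.
rewrite eqseq_cat ?size_map // => /andP[/eqP/eq_in_map g1 /eqP/eq_in_map g2].
exists g; rewrite polytabloid_permute; congr polytabloid; apply/ffunP => i.
have := g1 i; have := g2 i; rewrite !mem_enum ffunE => /(_ isT) /= -> /(_ isT) /= ->.
by case: (s i).
Qed.

End Specht.

(** * Completeness of the isotypic projections *)

Section Completeness.
Variables (R : realType) (n : nat).
Local Notation C := R[i].
Local Notation vec := 'rV[C]_(dimV n).
Local Notation Sn_mx := (tensor_perm_mx R).
Local Notation rG := (tensor_repr R n).
Local Notation P := (P_iso R n).
Local Notation T := (transp_sum R n).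
Local Notation lower := (lower_mx R n).
Local Notation weight := (weight_mx R n).

Lemma P_iso_comm x (A : 'M[C]_(dimV n)) : centgmx rG A -> P x *m A = A *m P x.
Proof.
move=> cA; apply: orth_proj_comm; first exact: component_centgmx.
exact/component_centgmx/centgmx_adj.
Qed.

Lemma P_iso_cent x : centgmx rG (P x).
Proof.
have mW g : (isotypic R n x *m Sn_mx g <= isotypic R n x)%MS.
  exact: (mxmoduleP (component_module rG _) g (in_setT g)).
by apply/centgmxP => g _; apply: orth_proj_comm; rewrite ?adj_perm_mx mW.
Qed.

Lemma P_iso_adj x : adj_mx (P x) = P x.
Proof. exact: orth_proj_adj. Qed.

Lemma P_iso_idem x : P x *m P x = P x.
Proof. exact: orth_proj_idem. Qed.

Lemma P_iso_transp_sum x : P x *m T = casimir R n x *: P x.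
Proof.
have : (P x <= isotypic R n x)%MS by rewrite -[P x]mul1mx orth_proj_sub.
by case/submxP => D ->; rewrite -mulmxA isotypic_transp_sum scalemxAr.
Qed.

Lemma casimir_inj x y : (x <= n./2)%N -> (y <= n./2)%N ->
  casimir R n x = casimir R n y -> x = y.
Proof.
move=> xn yn /eqP; rewrite -subr_eq0.
have xyn : (x + y <= n)%N.
  by rewrite (leq_trans (leq_add xn yn)) // addnn -{2}(odd_double_half n) leq_addl.
(* The last factor is a successor, hence nonzero, because [x + y <= n]. *)
have -> : casimir R n x - casimir R n y =
    2 * (x%:R - y%:R) * - (n - (x + y)).+1%:R.
  by rewrite -[(n - (x + y)).+1%:R]natr1 natrB // natrD /casimir; ring.
rewrite !mulf_eq0 oppr_eq0 !pnatr_eq0 orbF /= subr_eq0 eqr_nat.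
exact: eqP.
Qed.

(** Evaluating [P x *m T *m P y] from either side multiplies [P x *m P y] by two different
    eigenvalues. *)
Lemma P_iso_orth x y : (x <= n./2)%N -> (y <= n./2)%N -> x != y -> P x *m P y = 0.
Proof.
move=> xn yn xy.
have : P x *m T *m P y = P x *m (T *m P y) by rewrite mulmxA.
rewrite -(P_iso_comm y (transp_sum_cent R n)) !P_iso_transp_sum.
rewrite -scalemxAl -scalemxAr => /eqP; rewrite -subr_eq0 -scalerBl scaler_eq0 subr_eq0.
by case/orP => /eqP // /casimir_inj xy'; rewrite xy' ?eqxx in xy.
Qed.

Definition residue : 'M[C]_(dimV n) := 1%:M - \sum_(x < (n./2).+1) P x.

Lemma residue_comm A : centgmx rG A -> residue *m A = A *m residue.
Proof.
move=> cA; rewrite mulmxBl mulmxBr mul1mx mulmx1 mulmx_suml mulmx_sumr.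
by congr (_ - _); apply: eq_bigr => x _; apply: P_iso_comm.
Qed.

Lemma residue_cent : centgmx rG residue.
Proof.
apply/centgmxP => g Gg; rewrite mulmxBl mulmxBr mul1mx mulmx1 mulmx_suml mulmx_sumr.
by congr (_ - _); apply: eq_bigr => x _; apply: (centgmxP (P_iso_cent x)).
Qed.

Lemma P_iso_residue x : (x <= n./2)%N -> P x *m residue = 0.
Proof.
move=> xn; rewrite mulmxBr mulmx1 mulmx_sumr.
rewrite (bigD1 (Ordinal (xn : x < (n./2).+1)%N)) //= P_iso_idem big1 ?addr0 ?subrr //.
by move=> y yx; rewrite P_iso_orth // 1?eq_sym // -ltnS.
Qed.

Lemma residue_idem : residue *m residue = residue.
Proof.
rewrite {1}/residue mulmxBl mul1mx mulmx_suml big1 ?subr0 // => x _.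
by rewrite P_iso_residue // -ltnS.
Qed.

Lemma homog_weight (v : vec) x : homog v x <-> v *m weight = x%:R *: v.
Proof.
split=> [vh|vw f].
  apply: amp_inj => f; rewrite amp_weight ampZ.
  have [->//|fx] := eqVneq (wt f) x.
  by rewrite (homog_amp vh) // !mulr0.
apply: contraNeq => fx; have /(congr1 (fun v => amp v f)) := vw.
rewrite amp_weight ampZ => /eqP; rewrite -subr_eq0 -mulrBl mulf_eq0 subr_eq0 eqr_nat.
by rewrite (negbTE fx).
Qed.

Lemma homog_comm (v : vec) x A : A *m weight = weight *m A -> homog v x ->
  homog (v *m A) x.
Proof.
move=> Aw /homog_weight vw; apply/homog_weight.
by rewrite -mulmxA Aw mulmxA vw scalemxAl.
Qed.

Lemma homog_lower (v : vec) x : homog v x.+1 -> homog (v *m lower) x.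
Proof.
move=> vh f; apply: contraNeq => fx; rewrite amp_lower big1 // => k fk.
by rewrite (homog_amp vh) // wt_upd.
Qed.

Lemma lower_homog0 (v : vec) : homog v 0 -> v *m lower = 0.
Proof.
move=> vh; apply: amp_inj => f; rewrite amp0 amp_lower big1 // => k fk.
by rewrite (homog_amp vh) // wt_upd.
Qed.

Lemma valid_pairs_leq x (t : col_pairs n x) : valid_pairs t -> (x <= n./2)%N.
Proof.
rewrite valid_pairsE => /card_uniqP ut.
have := max_card (mem (points (pairs_of t))).
rewrite ut card_ord size_cat (size_map fst) (size_map snd) size_pairs_of addnn => xn.
by rewrite -(doubleK x) half_leq.
Qed.

(** The residue commutes with the group and preserves weight, so it multiplies a polytabloid by some
    [c]; one vector of the isotypic component then shows that [c] is zero. *)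
Lemma polytabloid_residue x (t : col_pairs n x) : polytabloid R t *m residue = 0.
Proof.
have [tv|/polytabloid_invalid ->] := boolP (valid_pairs t); last by rewrite mul0mx.
have [|c ec] := antisym_homog_polytabloid tv (antisym_cent residue_cent (polytabloid_antisym R tv)).
  apply: homog_comm; last exact: polytabloid_homog.
  exact/residue_comm/weight_cent.
(* The same [c] serves every tableau, since the valid ones form a single orbit. *)
have es (s : col_pairs n x) : polytabloid R s *m (residue - c%:M) = 0.
  have [sv|/polytabloid_invalid ->] := boolP (valid_pairs s); last by rewrite mul0mx.
  have [g ->] := polytabloid_trans R sv tv.
  rewrite mulmxBr mul_mx_scalar -mulmxA.
  have := centgmxP residue_cent g (in_setT _) => /= <-.
  by rewrite mulmxA ec scalemxAl subrr.
(* This row lies both in the span of the polytabloids, where the residue acts by [c], and in the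
   component, where it acts by zero. If it vanishes, so do all polytabloids. *)
set u := nz_row <<specht_mx R n x>>%MS.
have uW : (u <= specht_mx R n x)%MS by have := nz_row_sub <<specht_mx R n x>>%MS; rewrite genmxE.
have : u *m (residue - c%:M) = 0.
  by apply/sub_kermxP/(submx_trans uW)/sub_kermxP/specht_sub.
have uP : u *m P x = u by apply: orth_proj_id; apply: nz_row_component.
rewrite mulmxBr -{1}uP -mulmxA P_iso_residue ?(valid_pairs_leq tv) // mulmx0 sub0r.
rewrite mul_mx_scalar => /eqP; rewrite oppr_eq0 scaler_eq0 => /orP[/eqP c0|].
  by rewrite ec c0 scale0r.
rewrite nz_row_eq0 -submx0 genmxE submx0 => /eqP S0.
have := polytabloid_specht R t; rewrite S0 => /submxP[D ->].
by rewrite mulmx0 mul0mx.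
Qed.

Lemma points_cons (p : 'I_n * 'I_n) t : perm_eq (points (p :: t)) [:: p.1, p.2 & points t].
Proof. by rewrite /points /= perm_cons -[p.2 :: map snd t]cat1s perm_catCA. Qed.

(** The transposition of [a] and [b] commutes with those of the pairs in [t], being disjoint from
    them, so the old antisymmetries survive. *)
Lemma antisym_cons (v : vec) t (a b : 'I_n) : a \notin points t -> b \notin points t ->
  antisym v t -> antisym (v - v *m Sn_mx (tperm a b)) ((a, b) :: t).
Proof.
have repM (g h : {perm 'I_n}) : Sn_mx g *m Sn_mx h = Sn_mx (g * h)%g.
  by have [_ ->] := tensor_perm_mx_repr R n; rewrite ?inE.
move=> at_ bt va p; rewrite inE => /predU1P[->|pt] /=; rewrite mulmxBl -mulmxA repM.
  rewrite tperm2; have [-> _] := tensor_perm_mx_repr R n.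
  by rewrite mulmx1 opprB.
have -> : (tperm a b * tperm p.1 p.2 = tperm p.1 p.2 * tperm a b)%g.
  apply/permP => k; rewrite !permM.
  have [p1 p2] := (points_fst pt, points_snd pt).
  have [ap1 ap2] : p.1 != a /\ p.2 != a.
    by split; apply: contraNneq at_ => <-.
  have [bp1 bp2] : p.1 != b /\ p.2 != b.
    by split; apply: contraNneq bt => <-.
  case: (tpermP p.1 p.2 k) => [->|->|/eqP kp1 /eqP kp2].
  - by rewrite [tperm a b p.1]tpermD 1?eq_sym // tpermL tpermD // eq_sym.
  - by rewrite [tperm a b p.2]tpermD 1?eq_sym // tpermR tpermD // eq_sym.
  by rewrite tpermD //; case: tpermP => // _; rewrite eq_sym.
by rewrite -repM mulmxA va // mulNmx opprK addrC opprB.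
Qed.

(* Symmetry outside the pairs makes all nonzero terms of a lowered amplitude equal. *)
Lemma highest_weight_step (v : vec) x t : homog v x -> v *m lower = 0 ->
  uniq (points t) -> (size t < x)%N -> antisym v t ->
  (forall a b, a \notin points t -> b \notin points t -> v *m Sn_mx (tperm a b) = v) ->
  v = 0.
Proof.
move=> vh vl ut tx va vsym; apply: amp_inj => f; rewrite amp0.
apply: contraTeq isT => vf; exfalso; have fx := vh f vf.
have ft := antisym_neq va vf; have wf := wt_pairs ut ft.
(* The pairs account for only [size t < x] of the ones, so another one lies outside them. *)
have [j0 jt fj] : exists2 j, j \notin points t & f j.
  have : (0 < \sum_(i | i \notin points t) f i)%N.
    by rewrite -(ltn_add2l (size t)) addn0 -wf fx.
  rewrite lt0n sum_nat_eq0 negb_forall => /existsP[j]; rewrite negb_imply => /andP[jt fj].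
  by exists j => //; case: (f j) fj.
pose h := upd f j0 false.
have hj : ~~ h j0 by rewrite ffunE eqxx.
have := amp_lower v h; rewrite vl amp0 (bigID (mem (points t))) /= big1 ?add0r.
  have E k : ~~ h k -> k \notin points t -> amp v (upd h k true) = amp v f.
    move=> hk kt; rewrite -[in RHS](vsym j0 k jt kt) amp_perm; congr amp.
    apply/ffunP => i; rewrite !ffunE; move: hk; rewrite ffunE.
    have [->|kj] := eqVneq k j0.
      by move=> _; rewrite tperm1 perm1; case: eqP => // ->.
    case: tpermP => [->|->|/eqP/negbTE -> /eqP/negbTE ->] // fk.
      by rewrite eq_sym (negbTE kj) eqxx (negbTE fk).
    by rewrite eqxx fj.
  under eq_bigr => k /andP[hk kt] do rewrite E //.
  rewrite sumr_const => /esym/eqP; rewrite mulrn_eq0 (negbTE vf) orbF => /eqP/card0_eq E0.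
  by suff : j0 \in pred0 by []; rewrite -E0; apply/andP.
(* Filling a zero inside a pair makes both its bits one, which antisymmetry forbids on the
   support. *)
move=> k /andP[hk kt]; apply: contraTeq isT => vk; exfalso.
have := antisym_neq va vk; move: kt; rewrite mem_cat => /orP[]/mapP[p pt kp] /(_ p pt).
all: have := ft p pt; move: hk; rewrite kp !ffunE.
all: have pj1 : p.1 == j0 = false by apply/negbTE; apply: contraNneq jt => <-; exact: points_fst.
all: have pj2 : p.2 == j0 = false by apply/negbTE; apply: contraNneq jt => <-; exact: points_snd.
all: rewrite !eqxx ?pj1 ?pj2; case: (f p.1) (f p.2) => [] [] //=; by rewrite if_same.
Qed.

(** Induction on the number [k] of pairs still missing. With [x] pairs, [v] is a multiple of a
    polytabloid. Otherwise antisymmetrizing over a further pair gives zero by induction, so [v] is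
    symmetric outside [t] and [highest_weight_step] applies. *)
Lemma residue_highest_weight (v : vec) x : v *m residue = v -> homog v x ->
  v *m lower = 0 -> v = 0.
Proof.
move=> + + +; suff H k : forall (v : vec) t, v *m residue = v -> homog v x ->
    v *m lower = 0 -> (size t + k = x)%N -> uniq (points t) -> antisym v t -> v = 0.
  by move=> vQ vh vl; apply: (H x v [::]).
elim: k => [|k IH] {}v t vQ vh vl tx ut va.
  rewrite addn0 in tx; subst x.
  pose s : col_pairs n (size t) := [ffun i => tnth (in_tuple t) i].
  have st : pairs_of s = t.
    rewrite /pairs_of -[RHS](map_tnth_enum (in_tuple t)).
    by apply: eq_map => i; rewrite ffunE.
  have sv : valid_pairs s by rewrite valid_pairsE st.
  have [|c vc] := antisym_homog_polytabloid sv _ vh; first by rewrite st.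
  by rewrite -vQ vc -scalemxAl polytabloid_residue scaler0.
apply: (highest_weight_step vh vl ut _ va) => [|a b at_ bt].
  by rewrite -tx addnS ltnS leq_addr.
have [->|ab] := eqVneq a b.
  by rewrite tperm1; have [-> _] := tensor_perm_mx_repr R n; rewrite mulmx1.
have gM A : centgmx rG A -> v *m Sn_mx (tperm a b) *m A = v *m A *m Sn_mx (tperm a b).
  move=> cA; rewrite -mulmxA.
  by have := centgmxP cA (tperm a b) (in_setT _) => /= <-; rewrite mulmxA.
apply/eqP; rewrite eq_sym -subr_eq0; apply/eqP; apply: (IH _ ((a, b) :: t)).
- by rewrite mulmxBl gM ?residue_cent // vQ.
- apply/homog_weight; rewrite mulmxBl gM ?weight_cent //.
  by move/homog_weight: vh => ->; rewrite -scalemxAl scalerBr.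
- by rewrite mulmxBl gM ?lower_cent // vl mul0mx subr0.
- by rewrite /= addSn -addnS.
- by rewrite (perm_uniq (points_cons _ _)) /= inE negb_or ab at_ bt.
- exact: antisym_cons.
Qed.

(** By induction on the weight, the residue kills the lowered vector; hence [v *m residue] is killed
    by lowering. *)
Lemma homog_residue (v : vec) x : homog v x -> v *m residue = 0.
Proof.
elim: x v => [|x IH] v vh.
all: apply: residue_highest_weight;
  [by rewrite -mulmxA residue_idem
  |by apply: homog_comm vh; apply/residue_comm/weight_cent|].
all: rewrite -mulmxA (residue_comm (lower_cent R n)) mulmxA.
  by rewrite lower_homog0 // mul0mx.
by rewrite IH //; apply: homog_lower.
Qed.

Lemma sum_P_iso : \sum_(x < (n./2).+1) P x = 1%:M.
Proof.
apply/esym/eqP; rewrite -subr_eq0; apply/eqP/row_matrixP => i.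
rewrite row0 rowE; apply: (@homog_residue _ (wt (enum_val i))) => f.
rewrite /amp mxE eqxx /= -(inj_eq enum_val_inj) enum_rankK.
by case: (f =P _) => [->|_]; rewrite ?eqxx.
Qed.

End Completeness.

(** * The second moment of the sum of transpositions *)

Section SecondMoment.
Variables (R : realType) (n : nat).
Local Notation C := R[i].
Local Notation vec := 'rV[C]_(dimV n).

Lemma conj_casimir x : conjc (casimir R n x) = casimir R n x.
Proof.
by rewrite /casimir rmorphB rmorphD !rmorphXn rmorphB rmorphM !rmorph_nat.
Qed.

Lemma P_iso_normE (v : vec) x :
  (v *m P_iso R n x) *m adj_mx (v *m P_iso R n x) = v *m P_iso R n x *m adj_mx v.
Proof.
move: (P_iso R n x) (P_iso_adj R n x) (P_iso_idem R n x) => P adjP idemP.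
by rewrite adj_mxM adjP mulmxA -[v *m P *m P]mulmxA idemP.
Qed.

Lemma P_iso_ge0 (v : vec) x : 0 <= (v *m P_iso R n x *m adj_mx v) 0 0.
Proof. by rewrite -P_iso_normE row_norm_ge0. Qed.

Lemma row_decomp (p : nat) (v : vec) (A : 'M[C]_(dimV n, p)) :
  v *m A = \sum_(x < (n./2).+1) v *m P_iso R n x *m A.
Proof. by rewrite -[in LHS](mulmx1 v) -(sum_P_iso R n) mulmx_sumr mulmx_suml. Qed.

(** The shifted transposition sum is self-adjoint for real [c], so the squared norm of [w] is a
    quadratic form in its square, which acts as a scalar on each component. *)
Lemma casimir_moment (v w : vec) (c : C) : conjc c = c ->
  w = v *m transp_sum R n - c *: v ->
  \sum_(x < (n./2).+1) (casimir R n x - c) ^+ 2 * (v *m P_iso R n x *m adj_mx v) 0 0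
  = (w *m adj_mx w) 0 0.
Proof.
rewrite -mul_mx_scalar -mulmxBr => cc wE.
have Px (x : nat) : P_iso R n x *m (transp_sum R n - c%:M) =
    (casimir R n x - c) *: P_iso R n x.
  by rewrite mulmxBr P_iso_transp_sum mul_mx_scalar -scalerBl.
have adjT : adj_mx (transp_sum R n - c%:M) = transp_sum R n - c%:M.
  rewrite adj_mxB transp_sum_adj; congr (_ - _).
  by apply/matrixP => i j; rewrite !mxE eq_sym; case: eqP => _; rewrite ?conjc0.
rewrite wE adj_mxM adjT -mulmxA row_decomp summxE; apply: eq_bigr => x _.
have E : v *m P_iso R n x *m (transp_sum R n - c%:M) =
    (casimir R n x - c) *: (v *m P_iso R n x) by rewrite -mulmxA Px -scalemxAr.
by rewrite mulmxA E -scalemxAl mulmxA E scalemxAl scalerA -scalemxAl [RHS]mxE expr2.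
Qed.

Lemma sum_P_iso_norm (v : vec) :
  \sum_(x < (n./2).+1) (v *m P_iso R n x *m adj_mx v) 0 0 = (v *m adj_mx v) 0 0.
Proof.
by rewrite row_decomp summxE.
Qed.

End SecondMoment.

(** * The support of the state as a set of bit strings *)

Section DickeState.
Variables (m l : nat).
Hypothesis lm : (l <= m)%N.
Local Notation n := (2 * m)%N.
Implicit Types f : Bits n.

(** Fixing the total weight instead of the number of ones in the tail leaves the prefix as the only
    condition an exchange of positions can break. *)
Definition dicke_bits f : bool :=
  [forall i : 'I_n, (i < 2 * l)%N ==> (f i == (i < l)%N)] && (wt f == m).

Lemma sum_geq (k : nat) : (\sum_(i < n | k <= i) 1 = n - k)%N.
Proof.
by rewrite -(@big_geq_mkord _ _ _ k n xpredT (fun=> 1%N)) /= sum_nat_const_nat muln1.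
Qed.

Lemma card_prefix : (\sum_(i < n) (i < l)%N = l)%N.
Proof.
have ln : (l <= n)%N by lia.
have E : (\sum_(i < n | ~~ (i < l)) 1 = n - l)%N.
  by rewrite -sum_geq; apply: eq_bigl => i; rewrite -leqNgt.
have := sum1_card 'I_n; rewrite card_ord (bigID (fun i : 'I_n => (i < l)%N)) /= E.
rewrite [X in (X + _)%N]big_mkcond /= => E'.
apply/eqP; rewrite -(eqn_add2r (n - l)) subnKC // -[X in _ == X]E'.
by apply/eqP; congr (_ + _)%N; apply: eq_bigr => i _; case: ifP.
Qed.

Definition set_bits (B : {set 'I_n}) : Bits n := [ffun i : 'I_n => (i < l)%N || (i \in B)].

Lemma wt_split f : [forall i : 'I_n, (i < 2 * l)%N ==> (f i == (i < l)%N)] ->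
  wt f = (l + #|[set i : 'I_n | (2 * l <= i)%N && f i]|)%N.
Proof.
move=> /forallP fP; rewrite /wt -[X in _ = (X + _)%N]card_prefix -sum1_card.
rewrite [X in (_ + X)%N]big_mkcond -big_split /=; apply: eq_bigr => i _.
rewrite inE; have := fP i; case: (ltnP i (2 * l)) => /= [_ /eqP -> | li _].
  by rewrite addn0.
by rewrite ltnNge (leq_trans _ li) ?mul2n -?addnn ?leq_addr //; case: (f i).
Qed.

Lemma dicke_bitsE f :
  [&& [forall i : 'I_n, (i < l)%N ==> f i],
      [forall i : 'I_n, (l <= i < 2 * l)%N ==> ~~ f i]
    & #|[set i : 'I_n | (2 * l <= i)%N && f i]| == (m - l)%N] = dicke_bits f.
Proof.
rewrite /dicke_bits andbA.
have -> : [forall i : 'I_n, (i < l)%N ==> f i] &&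
          [forall i : 'I_n, (l <= i < 2 * l)%N ==> ~~ f i] =
          [forall i : 'I_n, (i < 2 * l)%N ==> (f i == (i < l)%N)].
  apply/andP/forallP => [[/forallP f1 /forallP f0] i | fP].
    apply/implyP => i2l; have := f1 i; have := f0 i; rewrite i2l andbT.
    by rewrite leqNgt; case: (i < l)%N (f i) => [] [].
  split; apply/forallP => i; apply/implyP => il; have := fP i.
    have i2 : (i < 2 * l)%N by lia.
    by rewrite i2 il /= => /eqP ->.
  by case/andP: il => li i2; rewrite i2 ltnNge li /= => /eqP ->.
case fE: [forall i : 'I_n, (i < 2 * l)%N ==> (f i == (i < l)%N)] => //=.
by rewrite (wt_split fE) -(eqn_add2l l) subnKC.
Qed.

(** Such a string is determined by its ones in the tail, an arbitrary set of [m - l] positions from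
    [2 * l] on. *)
Lemma card_dicke_bits : #|[pred f | dicke_bits f]| = 'C(n - 2 * l, m - l).
Proof.
have <- : (#|[set i : 'I_n | (2 * l <= i)%N]| = n - 2 * l)%N.
  by rewrite -sum_geq -sum1_card; apply: eq_bigl => i; rewrite inE.
rewrite -cards_draws -(@card_in_imset _ _ set_bits); last first.
  move=> B B'; rewrite !inE => /andP[/subsetP BA _] /andP[/subsetP BA' _] BB'.
  apply/setP => i; have := congr1 (fun f : Bits n => f i) BB'; rewrite !ffunE.
  case: (ltnP i l) => //= il _.
  have nB (D : {set 'I_n}) : {subset D <= [set i : 'I_n | (2 * l <= i)%N]} -> i \in D = false.
    by move=> DA; apply/negbTE/negP => /DA; rewrite inE; lia.
  by rewrite !nB.
apply: eq_card => f; rewrite inE; apply/idP/imsetP => [gf|[B + ->]].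
  have := gf; rewrite -dicke_bitsE => /and3P[_ _ fB].
  exists [set i : 'I_n | (2 * l <= i)%N && f i].
    by rewrite !inE fB andbT; apply/subsetP => i; rewrite !inE => /andP[].
  apply/ffunP => i; rewrite ffunE inE; case/andP: gf => /forallP/(_ i) + _.
  by case: (ltnP i (2 * l)) => /= [_ /eqP -> | li _]; [rewrite orbF | case: (f i); lia].
rewrite !inE => /andP[/subsetP BA /eqP cB].
have fE i : set_bits B i = (i < l)%N || (i \in B) by rewrite ffunE.
have nB (i : 'I_n) : i \in B -> (2 * l <= i)%N by move/BA; rewrite inE.
have fP : [forall i : 'I_n, (i < 2 * l)%N ==> (set_bits B i == (i < l)%N)].
  apply/forallP => i; apply/implyP => il; rewrite fE.
  by case: (boolP (i \in B)) => [/nB|_]; [lia | rewrite orbF].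
rewrite /dicke_bits fP (wt_split fP) (_ : [set i | _] = B) ?cB ?subnKC //=.
apply/setP => i; rewrite inE fE; case: (boolP (i \in B)) => [/nB -> |_].
  by rewrite orbT.
by rewrite orbF; lia.
Qed.

End DickeState.

(** * Counting exchanges into the support, and the resulting variance bound *)

Section DickeMoment.
Variables (R : realType) (m l : nat).
Hypothesis lm : (l <= m)%N.
Local Notation C := R[i].
Local Notation n := (2 * m)%N.
Local Notation xi := (Xi R n m (2 * l) l).
Local Notation K := 'C(n - 2 * l, m - l).
Local Notation good := (@dicke_bits m l).
Implicit Types f : Bits n.

Lemma K_gt0 : (0 < K)%N.
Proof. by rewrite bin_gt0; lia. Qed.

Definition dicke_amp : C := (Num.sqrt (K%:R : R))^-1%:C.

Lemma dicke_amp_norm : `|dicke_amp| ^+ 2 * K%:R = 1.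
Proof.
rewrite sqr_normc conjc_real -expr2 -rmorphXn /= exprVn sqr_sqrtr ?ler0n //.
have -> : K%:R = (K%:R : R)%:C :> C by rewrite rmorph_nat.
rewrite -rmorphM /= mulVf ?rmorph1 //.
by rewrite pnatr_eq0 -lt0n K_gt0.
Qed.

Lemma amp_Xi f : amp xi f = dicke_amp * (good f)%:R.
Proof.
rewrite /amp mxE enum_rankK -(dicke_bitsE lm f) /dicke_amp.
by case: ifP => _; rewrite ?mulr1 ?mulr0.
Qed.

Lemma Xi_norm : (xi *m adj_mx xi) 0 0 = 1.
Proof.
rewrite row_normE (sum_amp xi (fun z => `|z| ^+ 2)) -dicke_amp_norm -(card_dicke_bits lm).
under eq_bigr => f _ do rewrite amp_Xi.
rewrite -sum1_card natr_sum mulr_sumr [RHS]big_mkcond; apply: eq_bigr => f _.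
by rewrite unfold_in /=; case: good; rewrite ?mulr1 // mulr0 normr0 expr0n.
Qed.

(** Up to the factor [dicke_amp], the amplitude at [f] of the transposition sum applied to [xi]. *)
Definition swap_count f : nat :=
  (\sum_i \sum_j good (permute (tperm i j) f))%N.

Lemma good_swap f i j : good f ->
  good (permute (tperm i j) f) = (f i == f j) || ((2 * l <= i)%N && (2 * l <= j)%N).
Proof.
move=> gf; have [fij|fij] := eqVneq (f i) (f j); first by rewrite permute_tperm_id.
case/andP: (gf) => /forallP fP wf; rewrite /dicke_bits wt_permute wf andbT /=.
apply/forallP/andP => [H|[li lj] k]; last first.
  apply/implyP => kl; rewrite ffunE tpermD; first by have := fP k; rewrite kl.
    by apply: contraTneq kl => <-; rewrite -leqNgt.
  by apply: contraTneq kl => <-; rewrite -leqNgt.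
split; rewrite leqNgt; apply/negP => kl.
  have := H i; have := fP i; rewrite kl ffunE tpermL /= => /eqP <-.
  by rewrite eq_sym (negbTE fij).
have := H j; have := fP j; rewrite kl ffunE tpermR /= => /eqP <-.
by rewrite (negbTE fij).
Qed.

(** Equal bits give [m ^ 2] ordered pairs for each value; unequal bits must both lie in the tail,
    which holds [m - l] ones and as many zeros. *)
Lemma swap_count_good f : good f ->
  swap_count f = (2 * m ^ 2 + 2 * (m - l) ^ 2)%N.
Proof.
move=> gf; case/andP: (gf) => fP /eqP wf.
pose w (i : 'I_n) := (2 * l <= i)%N.
have su : (\sum_i f i)%N = m by [].
have sv : (\sum_i ~~ f i)%N = m.
  have : (\sum_i f i + \sum_i ~~ f i = n)%N.
    rewrite -big_split /= -[RHS]card_ord -sum1_card.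
    by apply: eq_bigr => i _; case: (f i).
  by rewrite su; lia.
have swu : (\sum_i (w i && f i) = m - l)%N.
  have E := wt_split lm fP; rewrite wf in E.
  apply: (@addnI l); rewrite subnKC // [RHS]E -sum1_card [in RHS]big_mkcond.
  by congr (_ + _)%N; apply: eq_bigr => i _; rewrite inE; case: (_ && _).
have swv : (\sum_i (w i && ~~ f i) = m - l)%N.
  have : (\sum_i (w i && f i) + \sum_i (w i && ~~ f i) = n - 2 * l)%N.
    rewrite -big_split /= -sum_geq [RHS]big_mkcond; apply: eq_bigr => i _.
    by rewrite -/(w i); case: (w i) (f i) => [] [].
  by rewrite swu; lia.
transitivity (\sum_i \sum_j (f i * f j + ~~ f i * ~~ f j
    + (w i && f i) * (w j && ~~ f j) + (w i && ~~ f i) * (w j && f j)))%N.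
  apply: eq_bigr => i _; apply: eq_bigr => j _; rewrite good_swap // -/(w i) -/(w j).
  by case: (f i) (f j) (w i) (w j) => [] [] [] [].
under eq_bigr => i _ do rewrite !big_split /=.
rewrite !big_split /= -!big_distrlr /= su sv swu swv; lia.
Qed.

(** A string of weight [m] outside the support has a wrong bit [b] in the prefix, and a successful
    exchange must involve [b]. Any other weight gives no exchange at all. *)
Lemma swap_count_bad f : ~~ good f -> (swap_count f <= 2 * n)%N.
Proof.
move=> gf; have [wf|wf] := eqVneq (wt f) m; last first.
  rewrite /swap_count big1 // => i _; rewrite big1 // => j _.
  by rewrite /dicke_bits wt_permute (negbTE wf) andbF.
have [b bl fb] : exists2 b : 'I_n, (b < 2 * l)%N & f b != (b < l)%N.
  move: gf; rewrite /dicke_bits wf eqxx andbT negb_forall => /existsP[b].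
  by rewrite negb_imply => /andP[bl fb]; exists b.
apply: (@leq_trans (\sum_(i < n) \sum_(j < n) ((i == b) + (j == b)))%N).
  apply: leq_sum => i _; apply: leq_sum => j _.
  have [->|ib] := eqVneq i b; first by case: good.
  have [->|jb] := eqVneq j b; first by case: good.
  rewrite leqn0 eqb0; apply: contra fb => /andP[/forallP/(_ b)].
  by rewrite bl ffunE tpermD.
have s1 : (\sum_(i < n) (i == b) = 1)%N.
  by rewrite (bigD1 b) //= eqxx big1 // => i /negbTE ->.
under eq_bigr => i _ do rewrite big_split /= s1 sum_nat_const card_ord.
by rewrite big_split /= -big_distrr /= s1 sum_nat_const card_ord; lia.
Qed.

(** For each of the [n ^ 2] ordered pairs the exchange is a bijection of bit strings, so it reaches
    the support [K] times. *)
Lemma sum_swap_count : (\sum_f swap_count f = n ^ 2 * K)%N.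
Proof.
rewrite /swap_count exchange_big /=.
under eq_bigr => i _.
  rewrite exchange_big /=.
  under eq_bigr => j _.
    have -> : (\sum_f good (permute (tperm i j) f) = K)%N.
      have inj : injective (permute (tperm i j)).
        move=> f f' /ffunP ff'; apply/ffunP => k; have := ff' (tperm i j k).
        by rewrite !ffunE tpermK.
      rewrite -(card_dicke_bits lm) -sum1_card [RHS]big_mkcond [RHS](reindex_inj inj) /=.
      by apply: eq_bigr => f _; rewrite unfold_in /=; case: good.
    over.
  rewrite sum_nat_const card_ord; over.
by rewrite sum_nat_const card_ord; lia.
Qed.

Lemma Xi_variance :
  forall w, w = xi *m transp_sum R n - casimir R n l *: xi ->
  (w *m adj_mx w) 0 0 <= (4 * l ^ 2 + 2 * n ^ 3)%:R.
Proof.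
move=> w wE.
have ampw f : amp w f = dicke_amp * ((swap_count f)%:R - casimir R n l * (good f)%:R).
  rewrite wE ampB ampZ amp_Xi mulrBr mulrCA; congr (_ - _).
  rewrite mulmx_sumr amp_sum natr_sum mulr_sumr; apply: eq_bigr => i _.
  rewrite mulmx_sumr amp_sum natr_sum mulr_sumr; apply: eq_bigr => j _.
  by rewrite amp_perm amp_Xi.
rewrite row_normE (sum_amp w (fun z => `|z| ^+ 2)).
(* On the support the deviation is exactly [2 * l]; outside, one factor of the squared count is
   bounded by [2 * n] and the other kept for the exact total. *)
apply: (@le_trans _ _ (\sum_f `|dicke_amp| ^+ 2 *
   (4 * l ^ 2 * good f + 2 * n * swap_count f)%N%:R)).
  apply: ler_sum => f _; rewrite ampw normrM exprMn ler_wpM2l ?exprn_ge0 //.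
  have [gf|gf] := boolP (good f).
    rewrite mulr1 muln1 swap_count_good // (_ : _ - _ = (2 * l)%:R); last first.
      rewrite natrD !natrM ?natrX natrB // /casimir !natrM; ring.
    by rewrite normr_nat -natrX ler_nat; lia.
  rewrite mulr0 subr0 muln0 add0n normr_nat -natrX ler_nat expnS expn1.
  by rewrite leq_mul2r swap_count_bad // orbT.
rewrite -mulr_sumr -natr_sum big_split /= -!big_distrr /= sum_swap_count.
have -> : (\sum_f good f = K)%N.
  rewrite -(card_dicke_bits lm) -sum1_card [RHS]big_mkcond.
  by apply: eq_bigr => f _; rewrite unfold_in /=; case: good.
rewrite (_ : (_ + _)%N = K * (4 * l ^ 2 + 2 * n ^ 3))%N; last by lia.
by rewrite natrM mulrA dicke_amp_norm mul1r.
Qed.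

End DickeMoment.

(** * Concentration *)

Section Concentration.
Variable F : realFieldType.

(** A pointwise Markov bound: beyond [e], the ratio of [y] to [e] exceeds 1 in size and its cube can
    be inserted. *)
Lemma norm_le_quartic (e y : F) : 0 < e -> `|y| <= e + y ^+ 4 / e ^+ 3.
Proof.
move=> e0; have [ye|ye] := leP `|y| e.
  rewrite (le_trans ye) // lerDl mulr_ge0 ?exprn_even_ge0 // invr_ge0.
  exact/exprn_ge0/ltW.
apply: (@le_trans _ _ (y ^+ 4 / e ^+ 3)); last by rewrite lerDr (ltW e0).
rewrite ler_pdivlMr ?exprn_gt0 // -[y ^+ 4]ger0_norm ?exprn_even_ge0 // normrX [_ ^+ 4]exprS.
by rewrite ler_wpM2l // lerXn2r ?nnegrE ?(ltW e0) ?(ltW ye).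
Qed.

(** The eigenvalue difference is twice [x - l] times a cofactor of size [n + 1 - x - l], which is at
    least the distance from [x] to [l] when both are at most [n / 2]. *)
Lemma casimir_gap (n l x : F) : 2 * l <= n -> 2 * x <= n ->
  4 * (x - l) ^+ 4 <= ((x ^+ 2 + (n - x) ^+ 2 - 2 * x)
                       - (l ^+ 2 + (n - l) ^+ 2 - 2 * l)) ^+ 2.
Proof.
move=> ln xn; rewrite -subr_ge0.
have -> : ((x ^+ 2 + (n - x) ^+ 2 - 2 * x) - (l ^+ 2 + (n - l) ^+ 2 - 2 * l)) ^+ 2
  - 4 * (x - l) ^+ 4 = 4 * (x - l) ^+ 2 * ((n + 1 - 2 * x) * (n + 1 - 2 * l)) by ring.
by apply: mulr_ge0; [rewrite mulr_ge0 ?sqr_ge0|apply: mulr_ge0; lra].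
Qed.

Lemma mean_deviation (n l : nat) (r : 'I_(n./2).+1 -> F) (e : F) :
  (0 < n)%N -> (2 * l <= n)%N -> 0 < e ->
  (forall x, 0 <= r x) -> \sum_(x < (n./2).+1) r x = 1 ->
  \sum_(x < (n./2).+1) ((x%:R ^+ 2 + (n%:R - x%:R) ^+ 2 - 2 * x%:R)
          - (l%:R ^+ 2 + (n%:R - l%:R) ^+ 2 - 2 * l%:R)) ^+ 2 * r x
     <= (4 * l ^ 2 + 2 * n ^ 3)%:R ->
  `|\sum_(x < (n./2).+1) (x%:R / n%:R - l%:R / n%:R) * r x| <= e + (n%:R * e ^+ 3)^-1.
Proof.
move=> n0 ln e0 r0 r1 mom; set y := fun x : 'I_(n./2).+1 => x%:R / n%:R - l%:R / n%:R : F.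
have nF : 0 < n%:R :> F by rewrite ltr0n.
have y4 : \sum_(x < (n./2).+1) y x ^+ 4 * r x <= n%:R^-1.
  (* The moment bound is at most [4 * n ^ 3] since [2 * l <= n]; the denominator comes from
     [casimir_gap] and the scaling by [n]. *)
  have -> : n%:R^-1 = (4 * n ^ 3)%:R / (4 * n%:R ^+ 4) :> F.
    by rewrite natrM natrX; field; rewrite lt0r_neq0.
  rewrite ler_pdivlMr ?mulr_gt0 ?exprn_gt0 // mulr_suml.
  apply: (le_trans _ (le_trans mom _)); last first.
    by rewrite ler_nat; have := leq_mul ln ln; nia.
  apply: ler_sum => x _; rewrite mulrAC ler_wpM2r //.
  have -> : y x ^+ 4 * (4 * n%:R ^+ 4) = 4 * (x%:R - l%:R) ^+ 4.
    by rewrite /y; field; rewrite lt0r_neq0.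
  apply: casimir_gap; first by rewrite -natrM ler_nat.
  rewrite -natrM ler_nat; have := ltn_ord x; rewrite ltnS => xn.
  by rewrite (leq_trans (leq_mul (leqnn 2) xn)) // mul2n -{2}(odd_double_half n) leq_addl.
apply: le_trans (ler_norm_sum _ _ _) _.
apply: (@le_trans _ _ (\sum_(x < (n./2).+1) (e + y x ^+ 4 / e ^+ 3) * r x)).
  by apply: ler_sum => x _; rewrite normrM (ger0_norm (r0 x)) ler_wpM2r // norm_le_quartic.
under eq_bigr => x _ do rewrite mulrDl mulrAC.
rewrite big_split /= -mulr_sumr r1 mulr1 lerD2l -mulr_suml [(n%:R * _)^-1]invfM ler_wpM2r //.
by rewrite invr_ge0; exact/exprn_ge0/ltW.
Qed.

End Concentration.

(** * From the concentration bound to the limit *)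

Lemma expectation_deviation (R : realType) (m l : nat) (e : R) :
  (0 < m)%N -> (l <= m)%N -> 0 < e ->
  `|expect_X_over_n R (2 * m) m (2 * l) l - (l%:R / (2 * m)%:R)%:C|
    <= (e + ((2 * m)%:R * e ^+ 3)^-1)%:C.
Proof.
move=> m0 lm e0; set n := (2 * m)%N.
(* Nonnegative complex numbers are real, so the estimates can be made in [R]. *)
pose r (x : 'I_(n./2).+1) : R := complex.Re (pmf R n m (2 * l) l x).
have rE (x : 'I_(n./2).+1) : pmf R n m (2 * l) l x = (r x)%:C.
  by rewrite /r RRe_real // ger0_real // P_iso_ge0.
have natE k : k%:R = (k%:R : R)%:C :> R[i] by rewrite rmorph_nat.
have r1 : \sum_(x < (n./2).+1) r x = 1.
  apply: (@complexI R); rewrite rmorph_sum rmorph1 -(Xi_norm R lm) -sum_P_iso_norm.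
  by apply: eq_bigr => x _; apply: (etrans (esym (rE x))).
(* The masses sum to one, so the constant [l / n] moves under the sum. *)
have -> : expect_X_over_n R n m (2 * l) l - (l%:R / n%:R)%:C =
    (\sum_(x < (n./2).+1) (x%:R / n%:R - l%:R / n%:R) * r x)%:C.
  under [in RHS]eq_bigr => x _ do rewrite mulrBl.
  rewrite sumrB -mulr_sumr r1 mulr1 rmorphB rmorph_sum; congr (_ - _).
  apply: eq_bigr => x _.
  by rewrite rE (natE x) (natE n) -fmorphV -!rmorphM.
rewrite normc_def /= expr0n addr0 sqrtr_sqr lecR.
apply: mean_deviation => //; [lia|lia|by move=> x; rewrite -ler0c -rE P_iso_ge0|].
have := @Xi_variance R m l lm _ erefl.
rewrite -(casimir_moment (conj_casimir R n l) erefl) => mom.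
rewrite -lecR rmorph_sum (rmorph_nat (real_complex R)); apply: le_trans mom.
rewrite le_eqVlt; apply/orP; left; apply/eqP; apply: eq_bigr => x _.
rewrite rmorphM; congr (_ * _); last exact: esym (rE x).
by rewrite /casimir !(rmorphB, rmorphD, rmorphXn, rmorphM) !(rmorph_nat (real_complex R)).
Qed.

Theorem theoremB6 (R : realType) (alpha : R) :
  0 <= alpha <= 1 / 2 ->
  (forall eps : R, 0 < eps ->
     exists N : nat, forall m l : nat,
       (N <= 2 * m)%N ->
       (l%:R : R) = alpha * (2 * m)%:R ->
       `|expect_X_over_n R (2 * m) m (2 * l) l - alpha%:C| < eps%:C)
  /\
  (let beta := 1 / 2 - alpha in
   let delta := 1 / 2 - alpha in
   let gamma := alpha in
   alpha = (1 - Num.sqrt (1 - 4 * (alpha * gamma + alpha * delta + beta * gamma))) / 2).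
Proof.
case/andP=> a0 a12; split=> [eps eps0|]; last first.
  move=> beta delta gamma; rewrite /beta /delta /gamma.
  have -> : 1 - 4 * (alpha * alpha + alpha * (1 / 2 - alpha) + (1 / 2 - alpha) * alpha)
      = (1 - 2 * alpha) ^+ 2 by field.
  by rewrite sqrtr_sqr ger0_norm; [field|lra].
have e0 : 0 < eps / 2 by lra.
(* With deviation parameter [eps / 2], the remaining term is below [eps / 2] once [2 * m] exceeds
   the inverse fourth power of [eps / 2]; the successor also yields [0 < m]. *)
exists (Num.bound (((eps / 2) ^+ 4)^-1)).+1 => m l Nm la.
have m0 : (0 < m)%N by lia.
have nF : 0 < (2 * m)%:R :> R by rewrite ltr0n; lia.
have lm : (l <= m)%N.
  have : (l%:R : R) <= 1 / 2 * (2 * m)%:R by rewrite la ler_wpM2r // ltW.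
  have -> : 1 / 2 * (2 * m)%:R = m%:R :> R by rewrite natrM; field.
  by rewrite ler_nat.
have -> : alpha = l%:R / (2 * m)%:R by rewrite la mulfK // lt0r_neq0.
apply: le_lt_trans (expectation_deviation m0 lm e0) _; rewrite ltcR.
suff : ((2 * m)%:R * (eps / 2) ^+ 3)^-1 < eps / 2 by lra.
rewrite -[(_ * _ ^+ 3)^-1]mul1r ltr_pdivrMr ?(mulr_gt0 nF (exprn_gt0 3 e0)) // mulrCA -exprS.
rewrite -ltr_pdivrMr ?(exprn_gt0 4 e0) // mul1r.
have i0 : 0 <= ((eps / 2) ^+ 4)^-1 by rewrite invr_ge0 exprn_even_ge0.
by apply: lt_le_trans (archi_boundP i0) _; rewrite ler_nat ltnW.
Qed.
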